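(* Fix $\delta>0$ and let $T:\mathbb{N}\to\mathbb{N}_{\ge1}$ be a query budget depending on the dimension $d$. (1) If $\ln T(d)=o(d)$ as $d\to\infty$, then $\mathsf{ExcessErr}_d(T(d),\delta)\to+\infty$ as $d\to\infty$. (2) If $\ln T(d)/d\to+\infty$ as $d\to\infty$, then $\mathsf{ExcessErr}_d(T(d),\delta)\to 0$ as $d\to\infty$.
   Context: Linear reconstruction game: fix $d\ge 1$, a number of rounds $T\ge 0$ and a noise level $\delta>0$. An adversary holds a secret point $x^*\in\mathbb{R}^d$. In each round $t=1,\dots,T$ the reconstructor chooses a unit vector $v_t\in S^{d-1}$ (possibly adaptively, as a function of previous answers) and the adversary returns a real number $r_t$ with $|r_t-\langle x^*,v_t\rangle|\le\delta$. After $T$ rounds the reconstructor outputs $\hat x_T\in\mathbb{R}^d$. All strategies are deterministic. The optimal reconstruction error is $\mathrm{OPT}_d(T,\delta)=\inf_{\mathcal R}\sup_{x^*\in\mathbb{R}^d}\sup_{\mathcal A}\|\hat x_T-x^*\|_2$, where $\mathcal R$ ranges over reconstructor strategies for $T$ rounds and $\mathcal A$ over adversary answer strategies satisfying the noise constraint for the secret $x^*$. This quantity is nonincreasing in $T$; set $\mathrm{OPT}_d(\infty,\delta):=\lim_{T\to\infty}\mathrm{OPT}_d(T,\delta)$ and $\mathsf{ExcessErr}_d(T,\delta):=\mathrm{OPT}_d(T,\delta)-\mathrm{OPT}_d(\infty,\delta)$. *)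

(* Defs.v *)
From HB Require Import structures.
From mathcomp Require Import all_boot all_order all_algebra.
From mathcomp Require Import all_classical all_reals all_analysis.
Set Implicit Arguments. Unset Strict Implicit. Unset Printing Implicit Defensive.
Import Order.TTheory GRing.Theory Num.Theory.
Local Open Scope ring_scope.
Local Open Scope classical_set_scope.

Definition dotv (R : realType) (d : nat) (x y : 'rV[R]_d) : R :=
  \sum_(i < d) x 0 i * y 0 i.
Definition enorm (R : realType) (d : nat) (x : 'rV[R]_d) : R :=
  Num.sqrt (dotv x x).

(* A deterministic (adaptive) reconstructor strategy: the query in round t+1
   is a function of the history (r_1,...,r_t) of previous answers; the final
   output is a function of the full answer history. *)
Record strategy (R : realType) (d : nat) := Strategy {
  query : seq R -> 'rV[R]_d ;
  output : seq R -> 'rV[R]_d }.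

Definition valid_strategy (R : realType) (d : nat) (S : strategy R d) : Prop :=
  forall h : seq R, dotv (query S h) (query S h) = 1.

(* r is an answer sequence of length T that an adversary holding x may
   produce against S: each answer is within delta of <x, v_t>. *)
Definition consistent (R : realType) (d : nat) (S : strategy R d) (T : nat)
  (delta : R) (x : 'rV[R]_d) (r : seq R) : Prop :=
  size r = T /\
  forall t : nat, (t < T)%N ->
    `|nth 0 r t - dotv x (query S (take t r))| <= delta.

Definition worst_err (R : realType) (d : nat) (S : strategy R d) (T : nat)
  (delta : R) : \bar R :=
  ereal_sup [set e | exists x r, consistent S T delta x r /\
                                 e = (enorm (output S r - x))%:E].

(* OPT_d(T, delta), valued in the extended reals (it is +oo when T < d). *)
Definition OPT (R : realType) (d T : nat) (delta : R) : \bar R :=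
  ereal_inf [set worst_err S T delta | S in [set S : strategy R d | valid_strategy S]].

Definition OPT_inf (R : realType) (d : nat) (delta : R) : \bar R :=
  limn (fun T => OPT d T delta).

Definition ExcessErr (R : realType) (d T : nat) (delta : R) : \bar R :=
  (OPT d T delta - OPT_inf d delta)%E.

(* Main.v *)
(** Jung's theorem and the exact value of [OPT_inf] are not needed.

Upper bound: if unit vectors [v_t], [t < T], satisfy
[c |z| <= max_t |<z, v_t>|] for all [z], then after querying them the feasible
set shrunk by [c] has diameter at most [2 delta].  A set of diameter at most
[2 delta] admits answers consistent with all its points simultaneously, so any
strategy, of any length, can be simulated on the shrunk set:
[c OPT(T) <= OPT(T')] for every [T'], hence [c OPT(T) <= OPT_inf].  Normalized
integer vectors with [sum_i |p_i| <= k^2 d] have this property with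
[c = 1 - k^-2], and there are at most [(4 * 2^(k^2))^d] of them.

Lower bound: answer [0] to every query, which fixes the queries.  By a
Chernoff bound some sign vector has inner product at most [tau] with all of
them as soon as [2 T exp (- tau^2 / 8) < 1]; its two multiples of norm
[delta sqrt d / tau] are then both feasible, while
[OPT_inf] stays below [4 delta]. *)
Require Import Defs.
From HB Require Import structures.
From mathcomp Require Import all_boot all_order all_algebra.
From mathcomp Require Import all_classical all_reals all_analysis.
From mathcomp Require Import ring lra.
Import Order.TTheory GRing.Theory Num.Theory.
Local Open Scope ring_scope.
Local Open Scope classical_set_scope.
Set Implicit Arguments.
Unset Strict Implicit.

(** * Inner product and Euclidean norm *)

Lemma dotvC (R : realType) (d : nat) (x y : 'rV[R]_d) : dotv x y = dotv y x.
Proof. by apply: eq_bigr => i _; rewrite mulrC. Qed.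

Lemma dotvDl (R : realType) (d : nat) (x y z : 'rV[R]_d) :
  dotv (x + y) z = dotv x z + dotv y z.
Proof. by rewrite -big_split; apply: eq_bigr => i _; rewrite mxE mulrDl. Qed.

Lemma dotvZl (R : realType) (d : nat) (a : R) (x z : 'rV[R]_d) :
  dotv (a *: x) z = a * dotv x z.
Proof. by rewrite mulr_sumr; apply: eq_bigr => i _; rewrite mxE mulrA. Qed.

Lemma dotvNl (R : realType) (d : nat) (x z : 'rV[R]_d) :
  dotv (- x) z = - dotv x z.
Proof. by rewrite -scaleN1r dotvZl mulN1r. Qed.

Lemma dotvBl (R : realType) (d : nat) (x y z : 'rV[R]_d) :
  dotv (x - y) z = dotv x z - dotv y z.
Proof. by rewrite dotvDl dotvNl. Qed.

Lemma dotvZr (R : realType) (d : nat) (a : R) (x z : 'rV[R]_d) :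
  dotv z (a *: x) = a * dotv z x.
Proof. by rewrite dotvC dotvZl dotvC. Qed.

Lemma dotvDr (R : realType) (d : nat) (x y z : 'rV[R]_d) :
  dotv z (x + y) = dotv z x + dotv z y.
Proof. by rewrite dotvC dotvDl !(dotvC z). Qed.

Lemma dotvBr (R : realType) (d : nat) (x y z : 'rV[R]_d) :
  dotv z (x - y) = dotv z x - dotv z y.
Proof. by rewrite dotvC dotvBl !(dotvC z). Qed.

Lemma dotv0r (R : realType) (d : nat) (z : 'rV[R]_d) : dotv z 0 = 0.
Proof. by rewrite -(scale0r (0 : 'rV[R]_d)) dotvZr mul0r. Qed.

Lemma dotv_ge0 (R : realType) (d : nat) (x : 'rV[R]_d) : 0 <= dotv x x.
Proof. by apply: sumr_ge0 => i _; rewrite -expr2 sqr_ge0. Qed.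

Lemma dotv_eq0 (R : realType) (d : nat) (x : 'rV[R]_d) :
  dotv x x = 0 -> x = 0.
Proof.
move=> x0; apply/rowP => i; rewrite mxE; apply/eqP.
rewrite -sqrf_eq0 expr2; apply/eqP; move: i (erefl true).
by apply: psumr_eq0P x0 => i _; rewrite -expr2 sqr_ge0.
Qed.

Lemma enorm_ge0 (R : realType) (d : nat) (x : 'rV[R]_d) : 0 <= enorm x.
Proof. exact: sqrtr_ge0. Qed.

Lemma enorm0 (R : realType) (d : nat) : enorm (0 : 'rV[R]_d) = 0.
Proof. by rewrite /enorm dotv0r sqrtr0. Qed.

Lemma enorm_sqr (R : realType) (d : nat) (x : 'rV[R]_d) :
  enorm x ^+ 2 = dotv x x.
Proof. by rewrite sqr_sqrtr ?dotv_ge0. Qed.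

Lemma enormZ (R : realType) (d : nat) (a : R) (x : 'rV[R]_d) :
  enorm (a *: x) = `|a| * enorm x.
Proof.
by rewrite /enorm dotvZl dotvZr mulrA -expr2 sqrtrM ?sqr_ge0 // sqrtr_sqr.
Qed.

Lemma dotv_normalize (R : realType) (d : nat) (x : 'rV[R]_d) :
  x != 0 -> dotv ((enorm x)^-1 *: x) ((enorm x)^-1 *: x) = 1.
Proof.
move=> x0; have xx0 : dotv x x != 0 by apply: contra_neq x0 => /dotv_eq0.
rewrite dotvZl dotvZr mulrA -expr2 exprVn enorm_sqr mulVf //.
Qed.

Lemma cauchy_schwarz_unit (R : realType) (d : nat) (x u : 'rV[R]_d) :
  dotv u u = 1 -> `|dotv x u| <= enorm x.
Proof.
move=> u1; rewrite -(ler_pXn2r (n := 2)) ?nnegrE ?enorm_ge0 //.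
rewrite enorm_sqr real_normK ?num_real //.
have := dotv_ge0 (x - dotv x u *: u).
by rewrite dotvBl !dotvBr !dotvZl !dotvZr u1 (dotvC u x); nra.
Qed.

(** * Answer sequences and simultaneous consistency *)

(** Plays [S] against an adversary that answers the query [u] by [m u]; appending an answer leaves
    earlier prefixes, hence earlier queries, unchanged. *)
Lemma transcript (R : realType) (d : nat) (S : strategy R d)
    (m : 'rV[R]_d -> R) (T : nat) :
  exists r : seq R, size r = T /\
    forall t, (t < T)%N -> nth 0 r t = m (query S (take t r)).
Proof.
elim: T => [|T [r [sr hr]]]; first by exists [::].
exists (rcons r (m (query S r))); rewrite size_rcons sr; split=> // t.
rewrite ltnS nth_rcons sr leq_eqVlt => /orP[/eqP ->|tT].
  by rewrite ltnn eqxx -cats1 take_cat sr ltnn subnn take0 cats0.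
by rewrite tT hr // -cats1 takel_cat // sr ltnW.
Qed.

(* Answering [sup <K, u> - delta] is within [delta] of every [<x, u>], [x] in
   [K], because projections of [K] have length at most its diameter. *)
Lemma consistent_small_diam (R : realType) (d : nat) (S : strategy R d)
    (T : nat) (delta : R) (K : set 'rV[R]_d) :
  valid_strategy S ->
  (forall x y, K x -> K y -> enorm (x - y) <= 2 * delta) ->
  exists r, forall x, K x -> consistent S T delta x r.
Proof.
move=> Sv hK.
have [r [sr hr]] := transcript S
  (fun u => sup [set dotv x u | x in K] - delta) T.
exists r => x Kx; split=> // t tT; rewrite hr //.
set u := query S _.
have ub y : K y -> dotv y u <= dotv x u + 2 * delta.
  move=> Ky; have := cauchy_schwarz_unit (y - x) (Sv (take t r)).
  rewrite dotvBl => /(le_trans (ler_norm _)) /le_trans /(_ (hK _ _ Ky Kx)); lra.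
have h1 : sup [set dotv x u | x in K] <= dotv x u + 2 * delta.
  apply: ge_sup; first by exists (dotv x u), x.
  by move=> _ [y Ky <-]; exact: ub.
have h2 : dotv x u <= sup [set dotv x u | x in K].
  apply: ub_le_sup; last by exists x.
  by exists (dotv x u + 2 * delta) => _ [y Ky <-]; exact: ub.
rewrite ler_norml; apply/andP; split; lra.
Qed.

Lemma consistent_error_le (R : realType) (d T : nat) (delta : R)
    (S : strategy R d) (x : 'rV[R]_d) (r : seq R) :
  consistent S T delta x r ->
  ((enorm (output S r - x))%:E <= worst_err S T delta)%E.
Proof. by move=> h; apply: ereal_sup_ubound; exists x, r. Qed.

(** * Positivity, monotonicity and limit of the optimal error *)

Lemma worst_err_ge0 (R : realType) (d T : nat) (delta : R)
    (S : strategy R d) : 0 < delta -> (0 <= worst_err S T delta)%E.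
Proof.
move=> dp; have [r [sr hr]] := transcript S (dotv 0) T.
have hc : consistent S T delta 0 r.
  by split=> // t tT; rewrite hr // subrr normr0 ltW.
by apply: le_trans (consistent_error_le hc); rewrite lee_fin enorm_ge0.
Qed.

Lemma OPT_ge0 (R : realType) (d T : nat) (delta : R) :
  0 < delta -> (0 <= OPT d T delta)%E.
Proof.
by move=> dp; apply: le_ereal_inf_tmp => _ [S _ <-]; apply: worst_err_ge0.
Qed.

(** A longer game can imitate a shorter one by discarding the late answers before the output. *)
Lemma OPT_nonincreasing (R : realType) (d : nat) (delta : R) :
  {homo (fun T => OPT d T delta : \bar R) : n m / (n <= m)%N >-> (m <= n)%E}.
Proof.
move=> n m nm; apply: le_ereal_inf_tmp => _ [S Sv <-].
pose S' := Strategy (query S) (fun r => output S (take n r)).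
apply: (@le_trans _ _ (worst_err S' m delta)).
  by apply: ereal_inf_lbound; exists S'.
apply: ge_ereal_sup => _ [x [r [[sr hr] ->]]].
apply: (@consistent_error_le _ _ _ _ _ x); split.
  by rewrite size_take sr; case: ltngtP nm.
move=> t tn; rewrite nth_take // take_takel; last exact: ltnW.
by apply: hr; apply: leq_trans nm.
Qed.

Lemma OPT_infE (R : realType) (d : nat) (delta : R) :
  OPT_inf d delta = ereal_inf (range (fun T => OPT d T delta : \bar R)).
Proof.
by apply/cvg_lim => //; apply/ereal_nonincreasing_cvgn/OPT_nonincreasing.
Qed.

Lemma OPT_inf_le (R : realType) (d T : nat) (delta : R) :
  (OPT_inf d delta <= OPT d T delta :> \bar R)%E.
Proof. by rewrite OPT_infE; apply: ereal_inf_lbound; exists T. Qed.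

Lemma OPT_inf_ge0 (R : realType) (d : nat) (delta : R) :
  0 < delta -> (0 <= OPT_inf d delta)%E.
Proof.
by move=> dp; rewrite OPT_infE; apply: le_ereal_inf_tmp => _ [T _ <-]; apply: OPT_ge0.
Qed.

(** * Nonadaptive strategies and detecting families *)

Lemma OPT_le_nonadaptive (R : realType) (d T : nat) (delta B : R)
    (v : nat -> 'rV[R]_d) :
  (forall t, dotv (v t) (v t) = 1) ->
  (forall r : nat -> R, exists o, forall x,
    (forall t, (t < T)%N -> `|r t - dotv x (v t)| <= delta) ->
    enorm (o - x) <= B) ->
  (OPT d T delta <= B%:E)%E.
Proof.
move=> v1 /choice [g hg].
(* The query depends only on the round, read off from the history length; answers beyond the history
   are padded by [0]. *)
pose S := Strategy (fun h => v (size h)) (fun r => g (nth 0 r)).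
apply: (@le_trans _ _ (worst_err S T delta)).
  by apply: ereal_inf_lbound; exists S => // h; exact: v1.
apply: ge_ereal_sup => _ [x [r [[sr hr] ->]]]; rewrite lee_fin.
apply: hg => t tT; have := hr t tT.
by rewrite /= size_take sr tT.
Qed.

(** The inequality [c |z| <= max_t |<z, v_t>|], with an arbitrary upper bound [a] in place of the
    maximum. *)
Definition detects (R : realType) (d T : nat) (c : R) (v : nat -> 'rV[R]_d) :=
  forall (a : R) (z : 'rV[R]_d),
    (forall t, (t < T)%N -> `|dotv z (v t)| <= a) -> c * enorm z <= a.

Lemma detects_diam (R : realType) (d T : nat) (c delta : R)
    (v : nat -> 'rV[R]_d) (r : nat -> R) (x y : 'rV[R]_d) :
  detects T c v ->
  (forall t, (t < T)%N -> `|r t - dotv x (v t)| <= delta) ->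
  (forall t, (t < T)%N -> `|r t - dotv y (v t)| <= delta) ->
  c * enorm (x - y) <= 2 * delta.
Proof.
move=> hv hx hy; apply: hv => t tT; rewrite dotvBl.
have := hx _ tT; have := hy _ tT; rewrite !ler_norml => /andP[? ?] /andP[? ?].
apply/andP; split; lra.
Qed.

(** Any feasible point will do as output; if there is none, the output [0] is vacuously good. *)
Lemma OPT_le_diam (R : realType) (d T : nat) (c delta : R)
    (v : nat -> 'rV[R]_d) :
  0 < c -> (forall t, dotv (v t) (v t) = 1) -> detects T c v ->
  (OPT d T delta <= (2 * delta / c)%:E)%E.
Proof.
move=> c0 v1 hv; apply: (OPT_le_nonadaptive v1) => r.
have [[y hy]|no] := pselect (exists x : 'rV[R]_d,
    forall t, (t < T)%N -> `|r t - dotv x (v t)| <= delta).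
  exists y => x hx; rewrite ler_pdivlMr // mulrC.
  exact: detects_diam hv hy hx.
by exists 0 => x hx; case: no; exists x.
Qed.

(* After the queries [v] the feasible set, shrunk by [c], has diameter at most
   [2 * delta], so any other strategy can be simulated on the shrunk set. *)
Lemma OPT_le_simulate (R : realType) (d T T' : nat) (c delta : R)
    (v : nat -> 'rV[R]_d) :
  0 < delta -> 0 < c ->
  (forall t, dotv (v t) (v t) = 1) -> detects T c v ->
  (c%:E * OPT d T delta <= OPT d T' delta)%E.
Proof.
move=> dp c0 v1 hv; apply: le_ereal_inf_tmp => _ [S Sv <-].
have := worst_err_ge0 T' S dp.
case E : (worst_err S T' delta) => [e| |] // _; last by rewrite leey.
rewrite muleC -lee_pdivlMr // -EFinM; apply: (OPT_le_nonadaptive v1) => r.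
pose K := [set x : 'rV[R]_d |
  forall t, (t < T)%N -> `|r t - dotv x (v t)| <= delta].
have [r' hr'] : exists r', forall x, [set c *: x | x in K] x ->
    consistent S T' delta x r'.
  apply: consistent_small_diam => // _ _ [x Kx <-] [y Ky <-].
  by rewrite -scalerBr enormZ gtr0_norm //; apply: detects_diam hv Kx Ky.
(* [S] estimates the shrunk secret [c *: x], so its output is scaled back and its error divided by
   [c]. *)
exists (c^-1 *: output S r') => x Kx.
rewrite ler_pdivlMr // mulrC -[X in X * _]gtr0_norm // -enormZ.
rewrite scalerBr scalerA divff ?gt_eqF // scale1r -lee_fin -E.
by apply/consistent_error_le/hr'; exists x.
Qed.

(** * Integer vectors as a detecting family *)

(** Sign and absolute value are coded separately in a finite type. A zero coordinate has two codes,
    harmless for an upper bound on the count. *)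
Definition grid_vec (R : realType) (d L : nat)
    (f : {ffun 'I_d -> bool * 'I_L.+1}) : 'rV[R]_d :=
  \row_i ((-1) ^+ (f i).1 * (f i).2%:R).

Definition small_grid (d L : nat) : pred {ffun 'I_d -> bool * 'I_L.+1} :=
  [pred f : {ffun 'I_d -> bool * 'I_L.+1} | (\sum_i (f i).2 <= L)%N].

(* Markov's inequality for the weight [2 ^- (\sum_i (f i).2)], which factors
   over the coordinates. *)
Lemma card_small_grid (d L : nat) : (#|@small_grid d L| <= 2 ^ L * 4 ^ d)%N.
Proof.
have geo n : \sum_(a < n) (2^-1 : rat) ^+ a <= 2.
  suff -> : \sum_(a < n) (2^-1 : rat) ^+ a = 2 - 2 * 2^-1 ^+ n.
    by rewrite lerBlDr lerDl mulr_ge0 // exprn_ge0.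
  elim: n => [|n IH]; first by rewrite big_ord0 expr0; lra.
  by rewrite big_ord_recr /= IH exprSr; lra.
pose w (j : bool * 'I_L.+1) : rat := 2^-1 ^+ j.2.
have w0 f : 0 <= \prod_(i < d) w (f i).
  by apply: prodr_ge0 => i _; rewrite exprn_ge0.
rewrite -(ler_nat rat) natrM !natrX -sum1_card natr_sum.
apply: (@le_trans _ _ (2 ^+ L * \sum_(f | @small_grid d L f) \prod_i w (f i))).
  rewrite mulr_sumr; apply: ler_sum => f; rewrite inE => fL.
  rewrite /w prodrXr exprVn ler_pdivlMr ?exprn_gt0 // mul1r.
  by rewrite ler_eXn2l ?ltr1n.
rewrite ler_pM2l ?exprn_gt0 //.
apply: (@le_trans _ _ (\sum_(f : {ffun 'I_d -> bool * 'I_L.+1}) \prod_i w (f i))).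
  by rewrite big_mkcond; apply: ler_sum => f _; case: ifP.
rewrite -(bigA_distr_bigA (fun=> w)) prodr_const card_ord.
apply: lerXn2r; rewrite ?nnegrE //.
  by apply: sumr_ge0 => j _; rewrite exprn_ge0.
(* Two signs times a geometric sum of at most [2] give the factor [4] per coordinate. *)
rewrite -(pair_bigA _ (fun (b : bool) (a : 'I_L.+1) => 2^-1 ^+ a)) big_bool /=.
by have := geo L.+1; lra.
Qed.

(** Round each coordinate towards zero: it moves by less than [1], and the integer [a i] satisfies
    [a i <= (a i)^2 <= (w_i)^2], so the sum stays below [L]. *)
Lemma grid_approx (R : realType) (d L : nat) (w : 'rV[R]_d) :
  dotv w w <= L%:R ->
  exists2 f : {ffun 'I_d -> bool * 'I_L.+1}, small_grid f &
    dotv (w - grid_vec R f) (w - grid_vec R f) <= d%:R.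
Proof.
move=> wL; pose a i : nat := Num.trunc `|w 0 i|.
have ha i : (a i)%:R <= `|w 0 i| < (a i).+1%:R by exact: truncn_itv.
have a2 i : (a i)%:R <= w 0 i * w 0 i.
  rewrite -expr2 -real_normK ?num_real //.
  have /andP[h _] := ha i; apply: (@le_trans _ _ ((a i)%:R ^+ 2)).
    by rewrite -natrX ler_nat; case: (a i) => // n; rewrite leq_pmulr.
  by rewrite lerXn2r ?nnegrE.
have sa : (\sum_i a i <= L)%N.
  rewrite -(ler_nat R) natr_sum; apply: le_trans wL.
  by apply: ler_sum => i _; exact: a2.
have aL i : (a i < L.+1)%N.
  by rewrite ltnS (leq_trans _ sa) // (bigD1 i) //= leq_addr.
exists [ffun i => (w 0 i < 0, inord (a i))].
  rewrite /small_grid /=; under eq_bigr do rewrite ffunE inordK //; exact: sa.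
rewrite [leRHS](_ : _ = \sum_(i < d) 1); last by rewrite sumr_const card_ord.
apply: ler_sum => i _; rewrite !mxE ffunE /= inordK //.
have /andP[] := ha i; rewrite -natr1.
move=> + + ; case: (ltP (w 0 i) 0) => wi0.
  by rewrite expr1 (ltr0_norm wi0) => h1 h2; nra.
by rewrite expr0 (ger0_norm wi0) => h1 h2; nra.
Qed.

(** Scale [z] to [w] with [|w|^2 = k^2 d] and round it to [p]. Expanding [|w - p|^2 <= d] gives
    [c |w|^2 + |p|^2 <= 2 <w, p>], so the direction of [p] detects [z]. *)
Lemma exists_detecting (R : realType) (n k T : nat) :
  (1 < k)%N -> ((2 ^ k ^ 2 * 4) ^ n.+1 <= T)%N ->
  exists v : nat -> 'rV[R]_n.+1,
    (forall t, dotv (v t) (v t) = 1) /\ detects T (1 - k%:R ^- 2) v.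
Proof.
set d := n.+1 => k1 hT; pose L := (k ^ 2 * d)%N.
(* The zero grid vector has no direction; a basis vector replaces it to keep every query a unit
   vector. *)
pose unit (p : 'rV[R]_d) :=
  if p == 0 then delta_mx 0 0 else (enorm p)^-1 *: p.
pose f0 : {ffun 'I_d -> bool * 'I_L.+1} := [ffun=> (false, ord0)].
pose v t := unit (grid_vec R (nth f0 (enum (@small_grid d L)) t)).
have v1 t : dotv (v t) (v t) = 1.
  rewrite /v /unit; case: eqP => [_|/eqP/dotv_normalize //].
  rewrite /dotv (bigD1 ord0) //= big1 ?addr0 => [|i i0].
    by rewrite !mxE !eqxx mulr1.
  by rewrite !mxE (negbTE i0) andbF mulr0.
exists v; split=> // a z hz.
have k0 : 0 < k%:R :> R by rewrite ltr0n (ltn_trans _ k1).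
have c0 : 0 < 1 - k%:R ^- 2 :> R.
  by rewrite subr_gt0 invf_lt1 ?exprn_gt0 // exprn_egt1 // ?ltr1n.
have [->|z0] := eqVneq z 0.
  (* For [z = 0] the goal is [0 <= a], which follows from the first query since [T] is positive. *)
  have := hz 0 (leq_trans _ hT); rewrite expn_gt0 muln_gt0 expn_gt0.
  move=> /(_ isT) /(le_trans (normr_ge0 _)).
  by rewrite enorm0 mulr0.
have Z0 : 0 < enorm z.
  rewrite lt_def enorm_ge0 andbT; apply: contra_neq z0 => Z.
  by apply: dotv_eq0; rewrite -enorm_sqr Z expr0n.
have d0 : 0 < d%:R :> R by rewrite ltr0n.
pose s := k%:R * Num.sqrt d%:R / enorm z.
have s0 : 0 < s by rewrite divr_gt0 // mulr_gt0 // sqrtr_gt0.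
have sZ : s * enorm z = k%:R * Num.sqrt d%:R by rewrite divfK // gt_eqF.
have ww : dotv (s *: z) (s *: z) = k%:R ^+ 2 * d%:R.
  rewrite dotvZl dotvZr mulrA -expr2 -enorm_sqr -exprMn sZ exprMn.
  by rewrite sqr_sqrtr // ltW.
have wL : dotv (s *: z) (s *: z) <= L%:R by rewrite ww natrM natrX.
have [f fA] := grid_approx wL.
have vf : v (index f (enum (@small_grid d L))) = unit (grid_vec R f).
  by rewrite /v nth_index // mem_enum.
set p := grid_vec R f in vf *.
rewrite dotvBl !dotvBr (dotvC p) ww dotvZl -enorm_sqr => hp.
have P0 : 0 <= enorm p := enorm_ge0 p.
set c := 1 - _ in c0 *; have kc : k%:R ^+ 2 * d%:R * c = k%:R ^+ 2 * d%:R - d%:R.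
  by rewrite /c; field; rewrite gt_eqF.
have c1 : c <= 1 by rewrite /c lerBlDr lerDl invr_ge0 exprn_ge0 // ltW.
have kW : k%:R ^+ 2 * d%:R = (s * enorm z) ^+ 2.
  by rewrite sZ exprMn sqr_sqrtr // ltW.
have W0 : 0 < s * enorm z by rewrite mulr_gt0.
have key : c * (s * enorm z) ^+ 2 + enorm p ^+ 2 <= 2 * (s * dotv z p).
  by move: kc hp; rewrite kW; set W := s * enorm z; lra.
(* AM-GM: since [c <= 1], the left side of [key] is at least [c (W^2 + |p|^2) >= 2 c W |p|]. *)
have key2 : c * (s * enorm z) * enorm p <= s * dotv z p.
  move: key; set W := s * enorm z.
  have : 0 <= c * (W - enorm p) ^+ 2 by rewrite mulr_ge0 ?sqr_ge0 // ltW.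
  have : 0 <= (1 - c) * enorm p ^+ 2 by rewrite mulr_ge0 ?sqr_ge0 // subr_ge0.
  by rewrite !expr2; lra.
have pn0 : p != 0.
  apply/eqP => p0; move: key; rewrite p0 dotv0r !mulr0.
  apply/negP; rewrite -ltNge ltr_wpDr ?sqr_ge0 //.
  by rewrite mulr_gt0 // exprn_gt0.
have Pp : 0 < enorm p.
  rewrite lt_def P0 andbT; apply: contra_neq pn0 => Z.
  by apply: dotv_eq0; rewrite -enorm_sqr Z expr0n.
have iT : (index f (enum (@small_grid d L)) < T)%N.
  apply: leq_trans hT; rewrite expnMn -expnM.
  apply: leq_trans (card_small_grid d L).
  by rewrite cardE index_mem mem_enum.
have := hz _ iT; rewrite vf /unit (negbTE pn0) dotvZr.
move=> /(le_trans (ler_norm _)); apply: le_trans.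
rewrite [leRHS]mulrC ler_pdivlMr // -(ler_pM2l s0); apply: le_trans key2.
by rewrite le_eqVlt; apply/orP; left; apply/eqP; ring.
Qed.

(** * Chernoff bound for random signs *)

(** For [x > 1/2] use [x <= 2 x^2]. For [0 <= x <= 1/2], [1 + y <= exp y] at [y = -x] and [y = x]
    bounds the two terms by [1 / (1 - x)] and [1 / (1 + x)], hence by [1 + x + 2 x^2] and
    [1 - x + 2 x^2]. *)
Lemma cosh_le_expR (R : realType) (x : R) :
  expR x + expR (- x) <= 2 * expR (2 * x ^+ 2).
Proof.
wlog x0 : x / 0 <= x => [H|].
  have [/H //|x0] := leP 0 x.
  by have := H (- x); rewrite opprK sqrrN addrC; apply; lra.
have [xs|xl] := leP x 2^-1; last first.
  have : expR x <= expR (2 * x ^+ 2) by rewrite ler_expR; nra.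
  have : expR (- x) <= expR (2 * x ^+ 2) by rewrite ler_expR; nra.
  lra.
have := expR_ge1Dx (2 * x ^+ 2); have := expR_ge1Dx x.
have := expR_ge1Dx (- x); have : expR x * expR (- x) = 1.
  by rewrite expRN divff // gt_eqF // expR_gt0.
have := expR_gt0 x; have := expR_gt0 (- x).
move: (expR x) (expR (- x)) (expR (2 * x ^+ 2)) => p q e q0 p0 pq hq hp he.
have hp1 : p <= 1 + x + 2 * x ^+ 2.
  have : p * (1 - x) <= 1 by rewrite -[leRHS]pq ler_pM2l.
  have : 1 <= (1 + x + 2 * x ^+ 2) * (1 - x) by nra.
  have h0 : 0 < 1 - x by lra.
  by move=> h1 h2; rewrite -(ler_pM2r h0); lra.
have hq1 : q <= 1 - x + 2 * x ^+ 2.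
  have : q * (1 + x) <= q * p by rewrite ler_pM2l.
  rewrite [X in _ <= X -> _]mulrC pq.
  have : 1 <= (1 - x + 2 * x ^+ 2) * (1 + x) by nra.
  have h0 : 0 < 1 + x by lra.
  by move=> h1 h2; rewrite -(ler_pM2r h0); lra.
lra.
Qed.

Definition sign_vec (R : realType) (d : nat) (e : {ffun 'I_d -> bool}) :
    'rV[R]_d := \row_i (-1) ^+ (e i).

(** The moment generating function factors over independent signs; [|v| = 1] recombines the
    exponents. *)
Lemma sum_expR_sign_vec (R : realType) (d : nat) (s : R) (v : 'rV[R]_d) :
  dotv v v = 1 ->
  \sum_(e : {ffun 'I_d -> bool}) expR (s * dotv (sign_vec R e) v)
    <= 2 ^+ d * expR (2 * s ^+ 2).
Proof.
move=> v1; pose F (i : 'I_d) (b : bool) := expR (s * ((-1) ^+ b * v 0 i)).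
rewrite (eq_bigr (fun e : {ffun _} => \prod_i F i (e i))) => [|e _]; last first.
  rewrite /dotv mulr_sumr expR_sum; apply: eq_bigr => i _.
  by rewrite /F mxE.
rewrite -bigA_distr_bigA.
have -> : 2 ^+ d * expR (2 * s ^+ 2) =
    \prod_(i < d) (2 * expR (2 * (s * v 0 i) ^+ 2)).
  rewrite big_split /= prodr_const card_ord -expR_sum; congr (_ * expR _).
  rewrite -[LHS]mulr1 -v1 /dotv mulr_sumr; apply: eq_bigr => i _.
  by ring.
apply: ler_prod => i _; rewrite big_bool /= /F expr1 expr0 mul1r mulN1r mulrN.
by rewrite addrC cosh_le_expR addr_ge0 // expR_ge0.
Qed.

Lemma exists_sign_vec (R : realType) (d T : nat) (tau : R)
    (v : nat -> 'rV[R]_d) :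
  0 < tau -> (forall t, dotv (v t) (v t) = 1) ->
  (2 * T)%:R * expR (- (tau ^+ 2 / 8)) < 1 ->
  exists e, forall t, (t < T)%N -> `|dotv (sign_vec R e) (v t)| <= tau.
Proof.
move=> tau0 v1 hT; apply: contrapT => no.
(* This [s] minimizes the Chernoff exponent [2 s^2 - s tau], with value [- tau^2 / 8]. *)
pose s := tau / 4.
pose F (e : {ffun 'I_d -> bool}) := \sum_(t < T)
  (expR (s * dotv (sign_vec R e) (v t)) +
   expR (- s * dotv (sign_vec R e) (v t))).
(* If every sign vector violates some query, one term of each [F e] exceeds [exp (s tau)]. *)
have lo : 2 ^+ d * expR (tau ^+ 2 / 4) <= \sum_e F e.
  have -> : 2 ^+ d * expR (tau ^+ 2 / 4) =
      \sum_(e : {ffun 'I_d -> bool}) expR (tau ^+ 2 / 4).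
    by rewrite sumr_const card_ffun card_bool card_ord -[RHS]mulr_natl natrX.
  apply: ler_sum => e _.
  have [t tT ht] : exists2 t, (t < T)%N & tau < `|dotv (sign_vec R e) (v t)|.
    apply: contrapT => no'; apply: no; exists e => t tT.
    by rewrite leNgt; apply/negP => ht; apply: no'; exists t.
  rewrite /F (bigD1 (Ordinal tT)) //=; apply: ler_wpDr.
    by apply: sumr_ge0 => i _; rewrite addr_ge0 // expR_ge0.
  have s0 : 0 < s by rewrite /s divr_gt0.
  have -> : tau ^+ 2 / 4 = s * tau by rewrite /s; ring.
  move: ht; rewrite lter_normr => /orP[] ht.
    by apply: ler_wpDr; rewrite ?expR_ge0 // ler_expR ler_pM2l // ltW.
  apply: ler_wpDl; rewrite ?expR_ge0 // ler_expR mulNr -mulrN ler_pM2l //.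
  exact: ltW.
have hi : \sum_e F e <= (2 * T)%:R * (2 ^+ d * expR (tau ^+ 2 / 8)).
  rewrite exchange_big /=.
  rewrite [leRHS](_ : _ = \sum_(t < T) (2 * (2 ^+ d * expR (tau ^+ 2 / 8)))).
    apply: ler_sum => t _; rewrite big_split /=.
    have := sum_expR_sign_vec s (v1 t); have := sum_expR_sign_vec (- s) (v1 t).
    rewrite sqrrN (_ : 2 * s ^+ 2 = tau ^+ 2 / 8); last by rewrite /s; field.
    lra.
  by rewrite sumr_const card_ord natrM -[RHS]mulr_natl; ring.
have := le_trans lo hi; apply/negP; rewrite -ltNge.
rewrite mulrCA ltr_pM2l ?exprn_gt0 //.
have -> : tau ^+ 2 / 4 = tau ^+ 2 / 8 + tau ^+ 2 / 8 by field.
rewrite expRD -ltr_pdivrMr ?expR_gt0 //.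
rewrite mulfK ?gt_eqF ?expR_gt0 //.
by move: hT; rewrite expRN ltr_pdivrMr ?expR_gt0 // mul1r.
Qed.

(** * Bounds on the optimal and excess errors *)

Lemma OPT_ge (R : realType) (d T : nat) (delta tau : R) :
  0 < delta -> 0 < tau -> (2 * T)%:R * expR (- (tau ^+ 2 / 8)) < 1 ->
  ((delta / tau * Num.sqrt d%:R)%:E <= OPT d T delta)%E.
Proof.
move=> dp tau0 hT; apply: le_ereal_inf_tmp => _ [S Sv <-].
have [r [sr hr]] := transcript S (fun=> 0) T.
have [e he] := exists_sign_vec tau0 (fun t => Sv (take t r)) hT.
pose x := (delta / tau) *: sign_vec R e.
have rho0 : 0 < delta / tau by rewrite divr_gt0.
have cx (b : bool) : consistent S T delta ((-1) ^+ b *: x) r.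
  split=> // t tT; rewrite hr // sub0r normrN !dotvZl normrM normrX normrN1.
  rewrite expr1n mul1r normrM gtr0_norm // -ler_pdivlMl // invf_div divfK ?gt_eqF //.
  exact: he.
have xx : dotv x x = (delta / tau) ^+ 2 * d%:R.
  rewrite dotvZl dotvZr mulrA -expr2; congr (_ * _).
  rewrite /dotv (eq_bigr (fun=> 1)) => [|i _]; last by rewrite mxE -expr2 sqrr_sign.
  by rewrite sumr_const card_ord.
have := worst_err_ge0 T S dp.
have := consistent_error_le (cx true); have := consistent_error_le (cx false).
case: (worst_err S T delta) => [w| |] //; last by move=> *; rewrite leey.
rewrite expr0 expr1 scale1r scaleN1r opprK !lee_fin => h1 h2 w0.
rewrite -(ler_pXn2r (n := 2)) ?nnegrE //; last first.
  by rewrite mulr_ge0 ?sqrtr_ge0 // ltW.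
rewrite exprMn sqr_sqrtr // -xx.
have sq (y : 'rV[R]_d) : enorm y <= w -> dotv y y <= w ^+ 2.
  by move=> yw; rewrite -enorm_sqr lerXn2r ?nnegrE ?enorm_ge0.
(* Parallelogram law: the squared distances from the output [o] to [x] and [-x] average to
   [|o|^2 + |x|^2 >= |x|^2]. *)
move: (sq _ h1) (sq _ h2); rewrite dotvBl !dotvBr dotvDl !dotvDr (dotvC x).
by have := dotv_ge0 (output S r); lra.
Qed.

(** The grid with [k = 2] has [c = 3/4], so [2 delta / c <= 4 delta]. Finiteness makes the extended
    subtraction in [ExcessErr] meaningful. *)
Lemma OPT_inf_fin_num (R : realType) (n : nat) (delta : R) :
  0 < delta ->
  exists2 b : R, OPT_inf n.+1 delta = b%:E & 0 <= b <= 4 * delta.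
Proof.
move=> dp; have [v [v1 hv]] := @exists_detecting R n 2 _ isT (leqnn _).
have c0 : 0 < 1 - 2 ^- 2 :> R by lra.
have := le_trans (OPT_inf_le _ _ _) (OPT_le_diam delta c0 v1 hv).
have := OPT_inf_ge0 n.+1 dp.
case: (OPT_inf n.+1 delta) => [b| |] //; rewrite !lee_fin => b0 hb.
exists b => //; rewrite b0 (le_trans hb) // ler_pdivrMr //; lra.
Qed.

Lemma ExcessErr_lower (R : realType) (d T : nat) (delta rho : R) :
  0 < delta -> 0 < rho -> (0 < d)%N ->
  (2 * T)%:R * expR (- (delta ^+ 2 / (8 * rho ^+ 2) * d%:R)) < 1 ->
  ((rho - 4 * delta)%:E <= ExcessErr d T delta)%E.
Proof.
(* Chosen so that the lower bound [delta / tau * sqrt d] equals [rho]. *)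
case: d => // n dp rp _ hT; pose tau := delta * Num.sqrt n.+1%:R / rho.
have sp : 0 < Num.sqrt n.+1%:R :> R by rewrite sqrtr_gt0.
have tau0 : 0 < tau by rewrite divr_gt0 // mulr_gt0.
have := @OPT_ge _ n.+1 T delta tau dp tau0.
have -> : tau ^+ 2 / 8 = delta ^+ 2 / (8 * rho ^+ 2) * n.+1%:R.
  rewrite -[in RHS](@sqr_sqrtr _ n.+1%:R) // /tau; field.
  by rewrite gt_eqF.
have -> : delta / tau * Num.sqrt n.+1%:R = rho.
  by rewrite /tau; field; rewrite !gt_eqF.
move=> /(_ hT); rewrite /ExcessErr.
have [b -> /andP[b0 b4]] := @OPT_inf_fin_num R n delta dp.
case: (OPT n.+1 T delta) => [a| |] //.
  by rewrite -EFinB !lee_fin => ?; lra.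
by rewrite addye ?leey.
Qed.

(** [c OPT <= OPT_inf] bounds the excess by [k^-2 OPT]; then [OPT <= 2 delta / c <= 4 delta] and
    [k^-2 <= 1 / (2 k)]. *)
Lemma ExcessErr_upper (R : realType) (d T k : nat) (delta : R) :
  0 < delta -> (1 < k)%N -> (0 < d)%N -> ((2 ^ k ^ 2 * 4) ^ d <= T)%N ->
  (0 <= ExcessErr d T delta <= (4 * delta / k%:R)%:E)%E.
Proof.
case: d => // n dp k1 _ kT; have [v [v1 hv]] := @exists_detecting R n k T k1 kT.
have k2 : 2 <= k%:R :> R by rewrite ler_nat.
have ki : k%:R ^- 2 <= 2^-1 * k%:R^-1 :> R.
  by rewrite -invfM lef_pV2 ?posrE ?exprn_gt0 ?mulr_gt0 ?expr2 ?ler_wpM2r //; lra.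
have ki2 : k%:R^-1 <= 2^-1 :> R by rewrite lef_pV2 ?posrE //; lra.
set c : R := 1 - k%:R ^- 2 in hv.
have c0 : 0 < c by rewrite /c; lra.
have le1 := OPT_le_diam delta c0 v1 hv.
have le2 : (c%:E * OPT n.+1 T delta <= OPT_inf n.+1 delta)%E.
  rewrite OPT_infE; apply: le_ereal_inf_tmp => _ [T' _ <-].
  exact: OPT_le_simulate dp c0 v1 hv.
have := OPT_inf_le n.+1 T delta; move: le1 le2; rewrite /ExcessErr.
have [b -> /andP[b0 b4]] := @OPT_inf_fin_num R n delta dp.
case: (OPT n.+1 T delta) => [a| |] //.
rewrite -EFinB -EFinM !lee_fin ler_pdivlMr // => h1 h2 h3.
apply/andP; split; first lra.
have a4 : a <= 4 * delta by move: h1; rewrite /c; nra.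
apply: (@le_trans _ _ (a * (2^-1 * k%:R^-1))).
  apply: (@le_trans _ _ (a * k%:R ^- 2)); first by move: h2; rewrite /c; lra.
  by rewrite ler_wpM2l //; lra.
have : 0 <= k%:R^-1 :> R by rewrite invr_ge0; lra.
by nra.
Qed.

(** * Asymptotics in the dimension *)

Unset Implicit Arguments.

Theorem theorem3 (R : realType) (delta : R) (Tq : nat -> nat)
  (hdelta : 0 < delta) (hT : forall d, (1 <= Tq d)%N) :
  ((fun d : nat => (ln (Tq d)%:R / d%:R : R)) @ \oo --> 0 ->
     (fun d : nat => ExcessErr d (Tq d) delta) @ \oo --> +oo%E)
  /\
  ((fun d : nat => (ln (Tq d)%:R / d%:R : R)) @ \oo --> +oo ->
     (fun d : nat => ExcessErr d (Tq d) delta) @ \oo --> 0%E).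
Proof.
have T0 d : 0 < (Tq d)%:R :> R by rewrite ltr0n.
split=> hlim.
- apply/cvgeyPge => A.
  pose rho := `|A| + 4 * delta.
  have rp : 0 < rho by rewrite /rho; have := normr_ge0 A; lra.
  pose kappa := delta ^+ 2 / (8 * rho ^+ 2).
  have kp : 0 < kappa by rewrite divr_gt0 ?mulr_gt0 ?exprn_gt0.
  (* Half of the exponent [kappa d] absorbs [ln T]; the other half beats the factor [2] once
     [kappa d >= 2]. *)
  have k2 : 0 < kappa / 2 by lra.
  move/cvgrPdist_lt : hlim => /(_ _ k2) hlim.
  near=> d.
  have d0 : (0 < d)%N by near: d; exact: nbhs_infty_gt.
  have dk : 2 / kappa <= d%:R.
    by near: d; exact: nbhs_infty_ger.
  have : `|0 - ln (Tq d)%:R / d%:R| < kappa / 2 by near: d.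
  rewrite sub0r normrN => /(le_lt_trans (ler_norm _)).
  rewrite ltr_pdivrMr ?ltr0n // => hln.
  apply: (@le_trans _ _ (rho - 4 * delta)%:E).
    by rewrite lee_fin /rho addrK ler_norm.
  apply: ExcessErr_lower => //.
  rewrite -/kappa natrM -[X in _ * X * _](lnK (T0 d)) -mulrA -expRD.
  have hd : 2 <= kappa * d%:R by rewrite mulrC -ler_pdivrMr.
  have : expR (ln (Tq d)%:R - kappa * d%:R) <
      expR (- (kappa / 2 * d%:R)) by rewrite ltr_expR; lra.
  rewrite [in X in _ < X -> _]expRN.
  have h2 : 2 <= expR (kappa / 2 * d%:R).
    by apply: le_trans (expR_ge1Dx _); lra.
  have : (expR (kappa / 2 * d%:R))^-1 <= 2^-1 by rewrite lef_pV2 ?posrE //; lra.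
  lra.
- have near_le k : (1 < k)%N -> \forall d \near \oo,
      (0 <= ExcessErr d (Tq d) delta <= (4 * delta / k%:R)%:E)%E.
    move=> k1; pose C := (2 ^ k ^ 2 * 4)%N.
    have C0 : (0 < C)%N by rewrite muln_gt0 expn_gt0.
    (* [ln C <= ln T / d] says exactly that [C^d <= T], the size of the grid family. *)
    move/cvgryPge : hlim => /(_ (ln C%:R)) hlim; near=> d.
    have d0 : (0 < d)%N by near: d; exact: nbhs_infty_gt.
    have : ln C%:R <= ln (Tq d)%:R / d%:R :> R by near: d.
    rewrite ler_pdivlMr ?ltr0n // mulr_natr -lnXn ?ltr0n //.
    rewrite ler_ln ?posrE ?exprn_gt0 ?ltr0n // -natrX ler_nat.
    exact: ExcessErr_upper.
  apply/fine_cvgP; split.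
    near=> d.
    have : (0 <= ExcessErr d (Tq d) delta <= (4 * delta / 2)%:E)%E.
      by near: d; exact: near_le.
    by case: (ExcessErr d (Tq d) delta) => [a| |] /=; rewrite ?andbF.
  apply/cvgrPdist_lt => eps e0.
  (* One successor gets past [4 delta / eps]; the second ensures [1 < k]. *)
  pose k := (Num.trunc (4 * delta / eps)).+2.
  have hk : 4 * delta / k%:R < eps.
    rewrite ltr_pdivrMr // [ltRHS]mulrC -ltr_pdivrMr //.
    by apply: lt_trans (truncnS_gt _) _; rewrite ltr_nat.
  near=> d.
  have : (0 <= ExcessErr d (Tq d) delta <= (4 * delta / k%:R)%:E)%E.
    by near: d; exact: near_le.
  rewrite /=; case: (ExcessErr d (Tq d) delta) => [a| |] /=; rewrite ?andbF //.
  rewrite !lee_fin.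
  by move=> /andP[a0 ak]; rewrite sub0r normrN ger0_norm // (le_lt_trans ak).
Unshelve. all: by end_near.
Qed.
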